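(* Let $\mathcal{PG}$ be the class of perfect graphs. Then $R_1^{\mathcal{PG}}(4,10)=22$.
   Context: All graphs are finite and simple. For a graph $G$ and an integer $k\ge 0$, a set $S\subseteq V(G)$ is $k$-sparse if every vertex of $S$ has at most $k$ neighbours in $S$, and $k$-dense if every vertex of $S$ is non-adjacent to at most $k$ other vertices of $S$. A $k$-sparse (resp. $k$-dense) $j$-set is a $k$-sparse (resp. $k$-dense) set of exactly $j$ vertices. For a graph class $\mathcal{G}$, $R_k^{\mathcal{G}}(i,j)$ is the smallest $n$ such that every graph in $\mathcal{G}$ on $n$ vertices has a $k$-dense $i$-set or a $k$-sparse $j$-set. *)

(* Defs.v *)
From mathcomp Require Import all_boot.

Set Implicit Arguments.
Unset Strict Implicit.
Unset Printing Implicit Defensive.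

Record sgraph := SGraph {
  svertex :> finType;
  adj : rel svertex;
  adj_sym : symmetric adj;
  adj_irrefl : irreflexive adj
}.

Section Graph.
Variable G : sgraph.
Implicit Types S : {set G}.

Definition sparse (k : nat) S : bool :=
  [forall x in S, #|[set y in S | adj x y]| <= k].

Definition dense (k : nat) S : bool :=
  [forall x in S, #|[set y in S | (y != x) && ~~ adj x y]| <= k].

Definition clique S : bool :=
  [forall x in S, forall y in S, (x != y) ==> adj x y].

Definition clique_number : nat := \max_(S : {set G} | clique S) #|S|.

Definition colorable (k : nat) : bool :=
  [exists f : {ffun G -> 'I_k}, forall x, forall y, adj x y ==> (f x != f y)].

Lemma colorable_ex : exists k, colorable k.
Proof.
exists #|G|; apply/existsP; exists [ffun x => enum_rank x].
apply/'forall_forallP => x y; apply/implyP => xy.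
rewrite !ffunE (inj_eq enum_rank_inj).
by apply: contraTneq xy => ->; rewrite adj_irrefl.
Qed.

Definition chromatic_number : nat := ex_minn colorable_ex.

Definition induced_adj S : rel {x : G | x \in S} :=
  fun x y => adj (val x) (val y).

Lemma induced_adj_sym S : symmetric (@induced_adj S).
Proof. by move=> x y; apply: adj_sym. Qed.

Lemma induced_adj_irrefl S : irreflexive (@induced_adj S).
Proof. by move=> x; apply: adj_irrefl. Qed.

Definition induced S : sgraph :=
  SGraph (@induced_adj_sym S) (@induced_adj_irrefl S).

End Graph.

Definition perfect (G : sgraph) : Prop :=
  forall S : {set G}, chromatic_number (induced S) = clique_number (induced S).

Definition ramsey_property (C : sgraph -> Prop) (k i j n : nat) : Prop :=
  forall G : sgraph, C G -> #|G| = n ->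
    (exists S : {set G}, dense k S /\ #|S| = i) \/
    (exists S : {set G}, sparse k S /\ #|S| = j).

(* The number may fail to exist for a class C, hence a relation: it reads
   "R_k^C(i, j) exists and equals n". *)
Definition is_ramsey_number (C : sgraph -> Prop) (k i j n : nat) : Prop :=
  ramsey_property C k i j n /\
  (forall m : nat, ramsey_property C k i j m -> n <= m).

(* Main.v *)
(* Upper bound.  A perfect graph without 1-dense 4-set contains no 4-cycle and
   no 5-cycle as a subgraph.  Hence a vertex v together with its second
   neighbourhood induces a subgraph of maximum degree at most 1, while deleting
   the closed neighbourhood of a vertex (of an edge) costs 1 (costs 2) in the
   size of a 1-sparse set.  Writing (n, j) for "n vertices force a 1-sparse
   j-set", these two bounds give, from one pair to the next,
     (2,2) (4,3) (6,4) (8,5) (10,6) (13,7) (16,8) (19,9) (22,10).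
   At (22,10) equality forces a 4-regular graph with two triangles at every
   vertex, i.e. 44/3 triangles; a similar count settles the cubic case of
   (10,6), whose other case has a vertex of degree 2.
   Lower bound.  The line graph of the Heawood graph has 21 vertices, and a
   1-sparse set of t of them is a disjoint union of paths with at most 2 edges,
   covering at least 3t/2 of the 14 vertices, so that t <= 9. *)
Require Import Defs.
From mathcomp Require Import all_boot zify.

Set Implicit Arguments.
Unset Strict Implicit.
Unset Printing Implicit Defensive.

(** * Largest 1-sparse subsets of a vertex set *)

Section Sparse.
Variable G : sgraph.
Implicit Types (S T X R : {set G}) (x y z u v w : G).

Lemma adj_neq x y : adj x y -> x != y.
Proof. by apply: contraTneq => ->; rewrite adj_irrefl. Qed.

Lemma sparse1P T :
  reflect {in T & &, forall x y z, adj x y -> adj x z -> y = z} (sparse 1 T).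
Proof.
apply: (iffP forall_inP) => [sT x y z xT yT zT xy xz|sT x xT].
  by apply: (card_le1_eqP (sT x xT)); rewrite inE ?yT ?zT.
apply/card_le1_eqP => y z; rewrite !inE => /andP[yT xy] /andP[zT xz].
exact: (sT x).
Qed.

Definition alpha1 S := \max_(T : {set G} | (T \subset S) && sparse 1 T) #|T|.

Lemma leq_alpha1 S T : T \subset S -> sparse 1 T -> #|T| <= alpha1 S.
Proof. by move=> TS sT; apply: leq_bigmax_cond; rewrite TS. Qed.

Lemma alpha1_witness S :
  exists T, [/\ T \subset S, sparse 1 T & #|T| = alpha1 S].
Proof.
have s0 : sparse 1 (set0 : {set G}) by apply/sparse1P=> x ? ?; rewrite inE.
have [|T /andP[TS sT] eT] :=
  @eq_bigmax_cond _ [pred T : {set G} | (T \subset S) && sparse 1 T] (fun T => #|T|).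
  by apply/card_gt0P; exists set0; rewrite inE sub0set s0.
by exists T; split; rewrite // -eT.
Qed.

Lemma sparse1S S T : S \subset T -> sparse 1 T -> sparse 1 S.
Proof.
move=> /subsetP ST /sparse1P sT; apply/sparse1P => x y z xS yS zS.
by apply: sT; apply: ST.
Qed.

Lemma alpha1_sparse_set S j :
  j <= alpha1 S -> exists T, sparse 1 T /\ #|T| = j.
Proof.
have [T [_ sT <-]] := alpha1_witness S.
case/card_geqP => s [us <- sT']; exists [set x in s]; split.
  by apply: sparse1S sT; apply/subsetP => x; rewrite inE => /sT'.
by rewrite cardsE (card_uniqP us).
Qed.

Lemma alpha1S S T : S \subset T -> alpha1 S <= alpha1 T.
Proof.
move=> ST; have [U [US sU <-]] := alpha1_witness S.
by apply: leq_alpha1 => //; apply: subset_trans ST.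
Qed.

Lemma sparse1U X T :
  sparse 1 X -> sparse 1 T -> {in X & T, forall x y, ~~ adj x y} ->
  sparse 1 (X :|: T).
Proof.
move=> /sparse1P sX /sparse1P sT XT.
have TX : {in T & X, forall x y, ~~ adj x y}.
  by move=> x y xT yX; rewrite adj_sym XT.
apply/sparse1P => x y z; rewrite !inE.
case/orP=> xX /orP[] yX /orP[] zX xy xz;
  by [ apply: (sX x) | apply: (sT x)
     | move: xy; rewrite (negPf (XT _ _ xX yX))
     | move: xz; rewrite (negPf (XT _ _ xX zX))
     | move: xy; rewrite (negPf (TX _ _ xX yX))
     | move: xz; rewrite (negPf (TX _ _ xX zX))].
Qed.

Lemma leq_alpha1U S X R :
  X \subset S -> R \subset S -> sparse 1 X -> [disjoint X & R] ->
  {in X & R, forall x y, ~~ adj x y} -> #|X| + alpha1 R <= alpha1 S.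
Proof.
move=> XS RS sX dXR XR; have [T [TR sT <-]] := alpha1_witness R.
have /eqP -> : #|X| + #|T| == #|X :|: T|.
  by rewrite eq_sym (leq_card_setU X T).2 (disjointWr TR).
apply: leq_alpha1; first by rewrite subUset XS (subset_trans TR).
by apply: sparse1U => // x y xX /(subsetP TR); apply: XR.
Qed.

Lemma sparse1_small T : #|T| <= 2 -> sparse 1 T.
Proof.
move=> T2; apply/sparse1P => x y z xT yT zT xy xz.
apply/eqP; apply: contraLR T2 => yz; rewrite -ltnNge.
by apply/card_gt2P; exists x, y, z; rewrite yz adj_neq // eq_sym adj_neq.
Qed.

(** * Neighbourhoods, and the cost of deleting those of a vertex or an edge *)

Definition nbr S v := [set x in S | adj v x].
(** For a neighbour [u] of [v], these are the children of [u] in a breadth-first search of [S] from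
    [v]. *)
Definition child S v u := [set x in S | [&& adj u x, x != v & ~~ adj v x]].
Definition common S v u := [set x in S | adj v x && adj u x].

Lemma card_nbr S v u : v \in S -> u \in nbr S v ->
  #|nbr S u| = #|child S v u| + #|common S v u| + 1.
Proof.
rewrite !inE => vS /andP[uS vu].
rewrite (cardsD1 v) !inE vS adj_sym vu addnC; congr (_ + _).
rewrite -(cardsID [set x | adj v x]) addnC.
by congr (_ + _); apply: eq_card => x; rewrite !inE;
  case: (altP (x =P v)) => [->|_]; rewrite ?adj_irrefl ?andbF ?andbT //=;
  case: (x \in S); case: (adj v x); case: (adj u x).
Qed.

Lemma leq_alpha1_vertex S v : v \in S ->
  1 + alpha1 (S :\: (v |: nbr S v)) <= alpha1 S.
Proof.
move=> vS; rewrite -(cards1 v); apply: leq_alpha1U.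
- by rewrite sub1set.
- exact: subsetDl.
- by rewrite sparse1_small ?cards1.
- by rewrite disjoints1 !inE eqxx.
- move=> x y /set1P->; rewrite !inE => /andP[+ yS].
  by rewrite yS negb_or => /andP[].
Qed.

(** The removed set is the closed neighbourhood of the edge [vu], since a neighbour of [u] outside
    [v |: nbr S v] is a child of [u]. *)
Lemma leq_alpha1_edge S v u : v \in S -> u \in nbr S v ->
  2 + alpha1 (S :\: (v |: nbr S v :|: child S v u)) <= alpha1 S.
Proof.
rewrite inE => vS /andP[uS vu].
have <- : #|[set v; u]| = 2 by rewrite cards2 adj_neq.
apply: leq_alpha1U.
- by rewrite subUset !sub1set vS.
- exact: subsetDl.
- by rewrite sparse1_small // cards2 adj_neq.
- rewrite disjoints_subset; apply/subsetP => x /set2P[] ->; rewrite !inE ?eqxx //.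
  by rewrite uS vu orbT.
move=> x y xX; rewrite !inE => /andP[+ yS]; rewrite yS /= !negb_or.
case/andP => /andP[yv vy]; rewrite yv vy !andbT => uy.
by case/set2P: xX => ->.
Qed.

Lemma card_closed_nbr S v : #|v |: nbr S v| = #|nbr S v| + 1.
Proof. by rewrite cardsU1 inE adj_irrefl andbF addnC. Qed.

Lemma leq_card_edge_nbr S v u :
  #|v |: nbr S v :|: child S v u| <= #|nbr S v| + 1 + #|child S v u|.
Proof. by rewrite -card_closed_nbr leq_card_setU. Qed.

(** * Second neighbourhoods in graphs without 4-cycles and 5-cycles *)

(** Here and in [C5_free] the cycles are excluded as subgraphs, with or without chords. *)
Definition C4_free := forall x y u v : G,
  x != y -> adj x u -> adj y u -> adj x v -> adj y v -> u = v.

Definition C5_free := forall a b c d e : G,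
  adj a b -> adj b c -> adj c d -> adj d e -> adj e a ->
  uniq [:: a; b; c; d; e] = false.

Hypotheses (noC4 : C4_free) (noC5 : C5_free).

Lemma card_common_le1 S v u : v != u -> #|common S v u| <= 1.
Proof.
move=> vu; apply/card_le1_eqP => x y.
rewrite !inE => /and3P[_ vx ux] /and3P[_ vy uy].
exact: (noC4 vu).
Qed.

(** A common child would close a 4-cycle with [u], [v] and [w]. *)
Lemma child_disjoint S v u w : u \in nbr S v -> w \in nbr S v -> u != w ->
  [disjoint child S v u & child S v w].
Proof.
rewrite !inE => /andP[_ vu] /andP[_ vw] uw.
rewrite -setI_eq0; apply/eqP/setP => x; rewrite !inE; apply/negP.
case/andP => /and4P[_ ux xv _] /and4P[_ wx _ _].
have xv' : v = x by apply: (noC4 uw) => //; rewrite adj_sym.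
by rewrite xv' eqxx in xv.
Qed.

Definition dist2 S v := [set x in S | [&& x != v, ~~ adj v x &
  [exists u, (u \in nbr S v) && adj u x]]].

Lemma sum_card_child S v : \sum_(u in nbr S v) #|child S v u| = #|dist2 S v|.
Proof.
(* Empty sets outside [nbr S v] make the family disjoint over all indices. *)
pose F u := if u \in nbr S v then child S v u else set0.
have dF u w : u != w -> [disjoint F u & F w].
  rewrite /F => uw; case: ifP => Nu; last by rewrite -setI_eq0 set0I.
  case: ifP => Nw; last by rewrite -setI_eq0 setI0.
  exact: child_disjoint.
have -> : dist2 S v = \bigcup_u F u.
  apply/setP => x; rewrite inE; apply/idP/bigcupP.
    case/and4P => xS xv vx /existsP[u /andP[Nu ux]].
    by exists u; rewrite // /F Nu inE xS ux xv.
  case=> u _; rewrite /F; case: ifP => [Nu|_]; rewrite !inE //.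
  case/and4P => -> ux -> -> /=; apply/existsP; exists u.
  by rewrite Nu.
rewrite -sum1_card (partition_disjoint_bigcup _ _ dF) big_mkcond /=.
by apply: eq_bigr => u _; rewrite sum1_card /F; case: ifP; rewrite // cards0.
Qed.

(* An edge inside the second neighbourhood of v must join two children of the
   same neighbour of v, as otherwise it closes a 5-cycle through v; two such
   edges at one vertex would close a 4-cycle. *)
Lemma sparse1_dist2 S v : sparse 1 (v |: dist2 S v).
Proof.
have nbrs x y : x \in dist2 S v -> y \in dist2 S v -> adj x y ->
    forall u, u \in nbr S v -> adj u x -> adj u y.
  rewrite !inE => /and4P[_ xv vx _] /and4P[_ yv vy /existsP[p /andP[Np py]]].
  move=> xy u Nu ux; rewrite !inE in Np Nu.
  case/andP: Np => _ vp; case/andP: Nu => _ vu.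
  case: (altP (u =P p)) => [->//|up].
  have yp : adj y p by rewrite adj_sym.
  have pv : adj p v by rewrite adj_sym.
  have /= /negbT := noC5 vu ux xy yp pv.
  rewrite !inE !negb_or (adj_neq vu) (adj_neq vp) (adj_neq ux) (adj_neq xy) up.
  rewrite !(eq_sym v) xv yv (eq_sym y) (adj_neq py) /=.
  have -> : u != y by apply: contraNneq vy => <-.
  by have -> : x != p by apply: contraNneq vx => ->.
have vD x : x \in dist2 S v -> ~~ adj v x by rewrite inE => /and4P[].
apply: sparse1U; first by rewrite sparse1_small ?cards1.
  apply/sparse1P => x y z xD yD zD xy xz.
  have := xD; rewrite !inE => /and4P[_ _ vx /existsP[u /andP[Nu ux]]].
  have uy := nbrs _ _ xD yD xy _ Nu ux.
  have uz := nbrs _ _ xD zD xz _ Nu ux.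
  exact: (noC4 (adj_neq ux)).
by move=> x y /set1P-> /vD.
Qed.

Lemma leq_alpha1_dist2 S v : v \in S ->
  1 + \sum_(u in nbr S v) #|child S v u| <= alpha1 S.
Proof.
move=> vS; rewrite sum_card_child.
have -> : 1 + #|dist2 S v| = #|v |: dist2 S v|.
  by rewrite cardsU1 !inE eqxx andbF.
apply: leq_alpha1 (sparse1_dist2 S v); rewrite subUset sub1set vS.
by apply/subsetP => x; rewrite inE => /andP[].
Qed.

(* The sum counts ordered triangles, on which rotation acts freely. *)
Lemma sum_common_mod3 S :
  3 %| \sum_(v in S) \sum_(u in nbr S v) #|common S v u|.
Proof.
pose A := [set p : G * G * G | [&& p.1.1 \in S, p.1.2 \in S, p.2 \in S,
  adj p.1.1 p.1.2, adj p.1.2 p.2 & adj p.2 p.1.1]].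
have -> : \sum_(v in S) \sum_(u in nbr S v) #|common S v u| = #|A|.
  rewrite -sum1_card pair_big_dep /=.
  under eq_bigr do rewrite -sum1_card.
  rewrite pair_big_dep /=; apply: eq_bigl => -[[a b] c]; rewrite !inE /=.
  by rewrite (adj_sym a c); case: (a \in S); case: (b \in S); case: (c \in S);
     case: (adj a b); case: (adj c a); case: (adj b c).
pose f (p : G * G * G) := (p.1.2, p.2, p.1.1).
have f_inj : injective f by move=> [[a b] c] [[a' b'] c'] [-> -> ->].
rewrite -(fcard_order_set f_inj (n := 3) (a := mem A)) ?dvdn_mull //.
  apply/subsetP => -[[a b] c]; rewrite !inE /= => /and5P[_ _ _ ab _].
  apply/eqP; apply: (order_cycle (p := [:: (a, b, c); (b, c, a); (c, a, b)])).
  - by rewrite /= !eqxx.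
  - rewrite /= !inE !xpair_eqE (negPf (adj_neq ab)) /=.
    by rewrite (eq_sym b a) (negPf (adj_neq ab)) !andbF.
  - by rewrite inE eqxx.
move=> [[a b] c] _ /eqP<-; rewrite !inE /=.
by case: (a \in S); case: (b \in S); case: (c \in S);
     case: (adj a b); case: (adj c a); case: (adj b c).
Qed.

(** * Recursive bounds on the number of vertices *)

(** The pairs (n, j) of the table above, for subsets of the fixed graph [G]. The recursion never
    leaves [G], so the exclusion of short cycles is assumed only once. *)
Definition forces n j := forall S, n <= #|S| -> j <= alpha1 S.

Lemma forces_card n j :
  (forall S, #|S| = n -> j <= alpha1 S) -> forces n j.
Proof.
move=> H S /card_geqP[s [us ss sS]].
apply: (leq_trans (H [set x in s] _)).
  by rewrite cardsE (card_uniqP us).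
by apply: alpha1S; apply/subsetP => x; rewrite inE => /sS.
Qed.

Lemma forces1 : forces 1 1.
Proof.
apply: forces_card => S cS; rewrite -cS; apply: leq_alpha1 => //.
by apply: sparse1_small; rewrite cS.
Qed.

Lemma forces2 : forces 2 2.
Proof.
apply: forces_card => S cS; rewrite -cS; apply: leq_alpha1 => //.
by apply: sparse1_small; rewrite cS.
Qed.

(** With [m] vertices left outside the closed neighbourhood of [v], a 1-sparse [k]-set among them
    could be extended by [v]. *)
Lemma degree_bound m k S v : forces m k -> v \in S -> alpha1 S <= k ->
  #|S| <= m + #|nbr S v|.
Proof.
move=> fmk vS; apply: contraTT; rewrite -!ltnNge => lt.
apply: leq_trans (leq_alpha1_vertex vS); rewrite ltnS; apply: fmk.
have := cardsD S (v |: nbr S v).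
have := subset_leq_card (subsetIr S (v |: nbr S v)).
rewrite card_closed_nbr; lia.
Qed.

(** The argument of [degree_bound] around the edge [vu], whose two ends extend the 1-sparse set. *)
Lemma edge_bound m k S v u : forces m k -> v \in S -> u \in nbr S v ->
  alpha1 S <= k.+1 -> #|S| <= m + #|nbr S v| + #|child S v u|.
Proof.
move=> fmk vS vu; apply: contraTT; rewrite -!ltnNge => lt.
apply: leq_trans (leq_alpha1_edge vS vu); rewrite !ltnS; apply: fmk.
have := cardsD S (v |: nbr S v :|: child S v u).
have := subset_leq_card (subsetIr S (v |: nbr S v :|: child S v u)).
have := leq_card_edge_nbr S v u; lia.
Qed.

Lemma sum_child_ge S v c : (forall u, u \in nbr S v -> c <= #|child S v u|) ->
  #|nbr S v| * c <= \sum_(u in nbr S v) #|child S v u|.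
Proof. by move=> H; rewrite -sum_nat_const; apply: leq_sum. Qed.

Lemma cards3 (A : {set G}) : #|A| = 3 -> exists a b c,
  [/\ a != b, a != c, b != c, A = [set a; b; c] &
      forall F : G -> nat, \sum_(x in A) F x = F a + F b + F c].
Proof.
move=> cA; have [a aA] : exists a, a \in A by apply/card_gt0P; rewrite cA.
have : #|A :\ a| == 2 by move: cA; rewrite (cardsD1 a) aA; lia.
case/cards2P => b [c [bc eA]].
have : b \in A :\ a by rewrite eA !inE eqxx.
have : c \in A :\ a by rewrite eA !inE eqxx orbT.
rewrite !inE => /andP[ca _] /andP[ba _].
exists a, b, c; split; rewrite // 1?eq_sym //.
  by rewrite -(setD1K aA) eA setUA.
move=> F; rewrite -(setD1K aA) eA !big_setU1 ?big_set1 ?inE //=.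
  by rewrite addnA.
by rewrite negb_or !(eq_sym a) ba.
Qed.

Lemma commonC S u v : common S u v = common S v u.
Proof. by apply/setP => x; rewrite !inE; congr (_ && _); rewrite andbC. Qed.

Lemma nbrC S u v : v \in S -> u \in nbr S v -> v \in nbr S u.
Proof. by rewrite !inE adj_sym => -> /andP[_ ->]. Qed.

Lemma nbr_neq S u v : u \in nbr S v -> v != u.
Proof. by rewrite inE => /andP[_ /adj_neq]. Qed.

Lemma nbr_in S u v : u \in nbr S v -> u \in S.
Proof. by rewrite inE => /andP[]. Qed.

(** A neighbour of [v] adjacent to two others would lie on a 4-cycle through [v]. So the edges
    inside [nbr S v] form a matching, which cannot cover three vertices. *)
Lemma odd_degree_common S v : #|nbr S v| = 3 ->
  exists2 u, u \in nbr S v & #|common S v u| = 0.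
Proof.
case: (boolP [exists u in nbr S v, #|common S v u| == 0]).
  by case/exists_inP => u Nu /eqP cu0 _; exists u.
move=> /exists_inPn H /cards3[a [b [c [ab ac bc eN _]]]].
have {}H u : u \in nbr S v -> exists2 x, x \in nbr S v & adj u x.
  move=> vu; have /card_gt0P[x] : 0 < #|common S v u| by rewrite lt0n H.
  by rewrite !inE => /and3P[xS vx ux]; exists x; rewrite // inE xS.
have inN x : (x \in nbr S v) = [|| x == a, x == b | x == c].
  by rewrite eN !inE orbA.
have uniq2 x y z : [&& x \in nbr S v, y \in nbr S v & z \in nbr S v] ->
    y != z -> ~~ (adj x y && adj x z).
  case/and3P; rewrite !inE => /andP[_ vx] /andP[_ vy] /andP[_ vz] yz.
  by apply: contraNN yz => /andP[xy xz]; apply/eqP; apply: (noC4 (adj_neq vx)).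
have := uniq2 a b c; have := uniq2 b a c; have := uniq2 c a b.
have [|a' + aa'] := H a; first by rewrite inN eqxx.
have [|b' + bb'] := H b; first by rewrite inN eqxx orbT.
have [|c' + cc'] := H c; first by rewrite inN eqxx !orbT.
rewrite !inN !eqxx ?orbT /= => Hc Hb Ha /(_ isT ab) nc /(_ isT ac) nb /(_ isT bc) na.
have {Ha aa'} : adj a b || adj a c.
  by case/or3P: Ha aa' => /eqP->; rewrite ?adj_irrefl // => -> ; rewrite ?orbT.
have {Hb bb'} : adj b a || adj b c.
  by case/or3P: Hb bb' => /eqP->; rewrite ?adj_irrefl // => -> ; rewrite ?orbT.
have {Hc cc'} : adj c a || adj c b.
  by case/or3P: Hc cc' => /eqP->; rewrite ?adj_irrefl // => -> ; rewrite ?orbT.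
move: na nb nc; rewrite (adj_sym b a) (adj_sym c a) (adj_sym c b).
by case: (adj a b); case: (adj a c); case: (adj b c).
Qed.

Lemma common_nbr_le1 S v u : u \in nbr S v -> #|common S v u| <= 1.
Proof. by move/nbr_neq; apply: card_common_le1. Qed.

(** Each neighbour [u] of [v] spends at most two of its edges on [v] and on a triangle, so it has a
    child. If [v] has only three neighbours, one of them is in no triangle with [v] and has two
    children. *)
Lemma sum_child_ge4 S v : v \in S -> {in S, forall u, 3 <= #|nbr S u|} ->
  4 <= \sum_(u in nbr S v) #|child S v u|.
Proof.
move=> vS deg3.
have ch u : u \in nbr S v -> #|nbr S u| = #|child S v u| + #|common S v u| + 1.
  exact: card_nbr.
have ch1 u : u \in nbr S v -> 1 <= #|child S v u|.
  move=> Nu; have := ch u Nu; have := common_nbr_le1 Nu.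
  by have := deg3 u (nbr_in Nu); lia.
have := deg3 v vS; rewrite leq_eqVlt => /predU1P[d3|d4].
  have [u Nu cu0] := odd_degree_common (esym d3).
  have : 2 <= #|child S v u| by have := ch u Nu; have := deg3 u (nbr_in Nu); lia.
  have [a [b [c [_ _ _ eN ->]]]] := cards3 (esym d3).
  have := ch1 a; have := ch1 b; have := ch1 c.
  move: Nu; rewrite eN !inE !eqxx !orbT => /orP[/orP[]|] /eqP-> ; lia.
by have := sum_child_ge ch1; lia.
Qed.

(** In a counterexample [degree_bound] gives minimum degree 2. At a vertex of degree 2, [edge_bound]
    gives each neighbour [c] children, hence a 1-sparse set of size [2 * c + 1]. So the minimum
    degree is 3, and [sum_child_ge4] yields a 1-sparse 5-set. *)
Lemma forces_small n j m1 m2 c : j <= 5 -> j <= 2 * c + 1 ->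
  forces m1 j.-1 -> forces m2 j.-2 -> m1 + 2 <= n -> m2 + 2 + c <= n ->
  forces n j.
Proof.
move=> j5 jc f1 f2 m1n m2n; apply: forces_card => S cS.
rewrite leqNgt; apply/negP => aj.
have [v vS] : exists v, v \in S by apply/card_gt0P; rewrite cS; lia.
have deg2 u : u \in S -> 2 <= #|nbr S u|.
  move=> uS; have := degree_bound f1 uS; rewrite cS; lia.
have deg3 : {in S, forall u, 3 <= #|nbr S u|}.
  move=> u uS; have := deg2 u uS; rewrite leq_eqVlt => /predU1P[d2|//].
  have := leq_alpha1_dist2 uS.
  suff /sum_child_ge : forall w, w \in nbr S u -> c <= #|child S u w| by lia.
  by move=> w Nw; have := edge_bound f2 uS Nw; rewrite cS; lia.
by have := sum_child_ge4 vS deg3; have := leq_alpha1_dist2 vS; lia.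
Qed.

(** The argument of [forces_small] one degree higher: a vertex of degree 3 would yield a 1-sparse
    set of size [3 * c + 1]. *)
Lemma degree_ge4 S j m1 m2 c : alpha1 S < j -> j <= 3 * c + 1 ->
  forces m1 j.-1 -> forces m2 j.-2 -> m1 + 3 <= #|S| -> m2 + 3 + c <= #|S| ->
  {in S, forall v, 4 <= #|nbr S v|}.
Proof.
move=> aj jc f1 f2 m1n m2n v vS.
have : 3 <= #|nbr S v| by have := degree_bound f1 vS; lia.
rewrite leq_eqVlt => /predU1P[d3|//]; have := leq_alpha1_dist2 vS.
suff /sum_child_ge : forall w, w \in nbr S v -> c <= #|child S v w| by lia.
by move=> w Nw; have := edge_bound f2 vS Nw; lia.
Qed.

Lemma child_ge2 S v u : {in S, forall x, 4 <= #|nbr S x|} -> v \in S ->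
  u \in nbr S v -> 2 <= #|child S v u|.
Proof.
move=> deg4 vS Nu; have := card_nbr vS Nu; have := common_nbr_le1 Nu.
by have := deg4 u (nbr_in Nu); lia.
Qed.

(** Minimum degree 4 gives four neighbours with at least two children each, hence a 1-sparse set of
    size [1 + 4 * 2]. *)
Lemma forces_large n j m1 m2 c : j <= 9 -> j <= 3 * c + 1 ->
  forces m1 j.-1 -> forces m2 j.-2 -> 0 < n -> m1 + 3 <= n -> m2 + 3 + c <= n ->
  forces n j.
Proof.
move=> j9 jc f1 f2 n0 m1n m2n; apply: forces_card => S cS.
rewrite leqNgt; apply/negP => aj; rewrite -cS in n0 m1n m2n.
have deg4 := degree_ge4 aj jc f1 f2 m1n m2n.
have [v vS] : exists v, v \in S by apply/card_gt0P.
have := leq_alpha1_dist2 vS.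
have := sum_child_ge (fun u Nu => child_ge2 deg4 vS Nu).
by have := deg4 v vS; lia.
Qed.

Lemma forces22 : forces 19 9 -> forces 16 8 -> forces 22 10.
Proof.
move=> f1 f2; apply: forces_card => S cS.
rewrite leqNgt; apply/negP => aj.
have deg4 : {in S, forall x, 4 <= #|nbr S x|}.
  by apply: (degree_ge4 (c := 3) aj _ f1 f2); rewrite ?cS.
(* With at most 8 vertices in the second neighbourhood, all degrees are 4 and all 8 places are
   taken. The degrees of the neighbours of [v] sum to 16: 8 children, 4 returns to [v], and 4 for
   triangles, each of the two triangles being counted twice. *)
have tau v : v \in S -> \sum_(u in nbr S v) #|common S v u| = 4.
  move=> vS; have := leq_alpha1_dist2 vS.
  have := sum_child_ge (fun u Nu => child_ge2 deg4 vS Nu).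
  have d4 : forall x, x \in S -> #|nbr S x| = 4.
    move=> x xS; have := leq_alpha1_dist2 xS.
    have := sum_child_ge (fun u Nu => child_ge2 deg4 xS Nu).
    by have := deg4 x xS; lia.
  have : \sum_(u in nbr S v) (#|child S v u| + #|common S v u| + 1) =
         \sum_(u in nbr S v) 4.
    by apply: eq_bigr => u Nu; rewrite -card_nbr ?d4 // (nbr_in Nu).
  rewrite !big_split /= sum1_card sum_nat_const d4 //.
  have : \sum_(u in nbr S v) #|common S v u| <= 4.
    rewrite -(d4 v vS) -sum1_card; apply: leq_sum => u Nu.
    exact: common_nbr_le1.
  by lia.
(* The sum is 22 * 4 = 88, not a multiple of 3. *)
have := sum_common_mod3 S.
by rewrite (eq_bigr (fun=> 4) tau) sum_nat_const cS.
Qed.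

(** * The pair (10, 6) *)

Lemma sparse1_pairs (a b c d : G) :
  ~~ adj a c -> ~~ adj a d -> ~~ adj b c -> ~~ adj b d ->
  sparse 1 ([set a; b] :|: [set c; d]).
Proof.
move=> ac ad bc bd.
have small x y : sparse 1 [set x; y] by rewrite sparse1_small // cards2; case: eqP.
by apply: sparse1U => // x y /set2P[] -> /set2P[] ->.
Qed.

Lemma leq4_alpha1 R (a b c d : G) : uniq [:: a; b; c; d] ->
  [&& a \in R, b \in R, c \in R & d \in R] ->
  ~~ adj a c -> ~~ adj a d -> ~~ adj b c -> ~~ adj b d -> 4 <= alpha1 R.
Proof.
move=> abcd /and4P[aR bR cR dR] ac ad bc bd.
apply: leq_trans (leq_alpha1 _ (sparse1_pairs ac ad bc bd)).
  have <- : #|[:: a; b; c; d]| = 4 by rewrite (card_uniqP abcd).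
  by apply/subset_leq_card/subsetP => x; rewrite !inE !orbA.
by rewrite !subUset !sub1set aR bR cR dR.
Qed.

(** The excluded cycles rule out the edges [rs], [r w2] and [s w1]. The 1-sparse 4-set is then one
    of [{s, w2, t, r}], [{r, w1, t, s}] and [{r, w1, s, w2}], split into two pairs with no edge
    between them. The vertex [w] need not belong to [R]. *)
Lemma leq4_alpha1_children R (w w1 w2 r s t : G) :
  uniq [:: w; w1; w2; r; s; t] -> {subset [:: w1; w2; r; s; t] <= R} ->
  adj w w1 -> adj w w2 -> adj w1 r -> adj w2 s -> 4 <= alpha1 R.
Proof.
rewrite /= !inE !negb_or !andbT => /and5P[].
case/and5P=> ww1 ww2 wr ws wt /and4P[w12 w1r w1s w1t] /and3P[w2r w2s w2t].
case/andP=> rs rt st subR ew1 ew2 e1r e2s.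
have sym (x y : G) : x != y -> ((x != y) * (y != x))%type.
  by move=> xy; rewrite (eq_sym y) xy.
have U := (sym _ _ ww1, sym _ _ ww2, sym _ _ wr, sym _ _ ws, sym _ _ w12,
  sym _ _ w1r, sym _ _ w1s, sym _ _ w1t, sym _ _ w2r, sym _ _ w2s, sym _ _ w2t,
  sym _ _ rs, sym _ _ rt, sym _ _ st).
have inR x : x \in [:: w1; w2; r; s; t] -> x \in R by apply: subR.
have /and5P[w1R w2R rR sR tR] :
    [&& w1 \in R, w2 \in R, r \in R, s \in R & t \in R].
  by rewrite !inR ?inE ?eqxx ?orbT.
have [er1 es2 e2w] : [/\ adj r w1, adj s w2 & adj w2 w].
  by split; rewrite adj_sym.
have nrs : ~~ adj r s.
  apply/negP => ers; have := noC5 ew1 e1r ers es2 e2w.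
  by rewrite /= !inE !negb_or !U.
have nrw2 : ~~ adj r w2.
  apply/negP => e; have := noC4 wr ew1 er1 ew2 e.
  by move/eqP; rewrite (negPf w12).
have nsw1 : ~~ adj s w1.
  apply/negP => e; have := noC4 ws ew1 e ew2 es2.
  by move/eqP; rewrite (negPf w12).
have [/orP A | /norP[st' w2t']] := boolP (adj s t || adj w2 t); last first.
  apply: (@leq4_alpha1 R s w2 t r); 
    rewrite ?sR ?w2R ?rR ?tR 1?(adj_sym s r) 1?(adj_sym w2 r) //.
  by rewrite /= !inE !negb_or !U.
have [/orP B | /norP[rt' w1t']] := boolP (adj r t || adj w1 t); last first.
  apply: (@leq4_alpha1 R r w1 t s); rewrite ?sR ?w1R ?rR ?tR 1?(adj_sym w1 s) //.
  by rewrite /= !inE !negb_or !U.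
have [e12|n12] := boolP (adj w1 w2); last first.
  apply: (@leq4_alpha1 R r w1 s w2); rewrite ?sR ?w1R ?rR ?w2R 1?(adj_sym w1 s) //.
  by rewrite /= !inE !negb_or !U.
have C4' x y z u : adj x y -> adj y z -> adj z u -> adj u x ->
    x != z -> y != u -> False.
  by move=> xy yz zu ux xz /eqP; apply; apply: (noC4 xz) => //; rewrite adj_sym.
(* Now [w1] and [w2] are adjacent, and [t] has a neighbour in [{s, w2}] and one in [{r, w1}]; each
   combination closes a 4-cycle or a 5-cycle. *)
exfalso; case: A => A; case: B => B.
- have tr : adj t r by rewrite adj_sym.
  have /= := noC5 e12 e2s A tr er1.
  by rewrite !inE !negb_or !U.
- by apply: (C4' w1 w2 s t); rewrite // adj_sym.
- by apply: (C4' w2 w1 r t); rewrite // 1?adj_sym // eq_sym.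
- by apply: (C4' w w1 t w2); rewrite // adj_sym.
Qed.

Section Ten.
Variable S : {set G}.
Hypotheses (cardS : #|S| = 10) (alphaS : alpha1 S <= 5).
Hypotheses (f8 : forces 8 5) (f6 : forces 6 4).

Let deg2 v : v \in S -> 2 <= #|nbr S v|.
Proof. by move=> vS; have := degree_bound f8 vS alphaS; rewrite cardS; lia. Qed.

Let sum4 v : v \in S -> \sum_(u in nbr S v) #|child S v u| <= 4.
Proof. by move=> vS; have := leq_alpha1_dist2 vS; lia. Qed.

Let edge4 v u : v \in S -> u \in nbr S v -> 4 <= #|nbr S v| + #|child S v u|.
Proof. by move=> vS Nu; have := edge_bound f6 vS Nu; rewrite cardS; lia. Qed.

(** With minimum degree 3, each vertex would lie in exactly one triangle, counted twice in the sum
    over its neighbours. The total 10 * 2 would have to be a multiple of 3. *)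
Lemma ten_degree2 : exists2 v, v \in S & #|nbr S v| = 2.
Proof.
case: (boolP [exists v in S, #|nbr S v| == 2]).
  by case/exists_inP => v vS /eqP; exists v.
move=> /exists_inPn H; exfalso.
have deg3 : {in S, forall v, 3 <= #|nbr S v|}.
  by move=> v vS; have := deg2 vS; have := H v vS; lia.
have ch v u : v \in S -> u \in nbr S v ->
    [/\ 1 <= #|child S v u|, #|common S v u| <= 1 &
        #|nbr S u| = #|child S v u| + #|common S v u| + 1].
  move=> vS Nu; have := card_nbr vS Nu; have := common_nbr_le1 Nu.
  by have := deg3 u (nbr_in Nu); split=> //; lia.
(* The neighbour in no triangle with [v] takes at least two of the at most four children, so the
   other two have one child each. All inequalities become equalities. *)
have cubic v : v \in S -> #|nbr S v| = 3 ->
    {in nbr S v, forall u, #|nbr S u| = 3} /\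
    \sum_(u in nbr S v) #|common S v u| = 2.
  move=> vS d3; have [u Nu cu0] := odd_degree_common d3.
  have [_ _ eu] := ch v u vS Nu; have := deg3 u (nbr_in Nu).
  have [a [b [c [_ _ _ eN sumE]]]] := cards3 d3.
  have := sum4 vS; rewrite !sumE => sum4v du.
  have inN x : (x \in nbr S v) = [|| x == a, x == b | x == c].
    by rewrite eN !inE orbA.
  have [Na Nb Nc] : [/\ a \in nbr S v, b \in nbr S v & c \in nbr S v].
    by rewrite !inN !eqxx !orbT.
  have := ch _ _ vS Na; have := ch _ _ vS Nb; have := ch _ _ vS Nc.
  have := deg3 a (nbr_in Na); have := deg3 b (nbr_in Nb).
  have := deg3 c (nbr_in Nc) => dc db da [cc1 cc2 cc3] [cb1 cb2 cb3] [ca1 ca2 ca3].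
  move: Nu cu0; rewrite inN => /or3P[] /eqP-> cu0;
    (split; last by lia); by move=> x; rewrite inN => /or3P[] /eqP->; lia.
have {}cubic v : v \in S -> \sum_(u in nbr S v) #|common S v u| = 2.
  move=> vS; have [d3|d3] := eqVneq #|nbr S v| 3; first by case: (cubic v).
  have le1 u : u \in nbr S v -> 1 <= #|child S v u| by case/(ch _ _ vS).
  have := sum4 vS; have := sum_child_ge le1.
  move=> lt4 le4; have d4 : #|nbr S v| = 4 by have := deg3 v vS; lia.
  have [u Nu] : exists u, u \in nbr S v by apply/card_gt0P; rewrite d4.
  (* At a vertex of degree 4 every neighbour has just one child, hence degree 3; but all neighbours
     of a cubic vertex are cubic, including [v]. *)
  suff d3u : #|nbr S u| = 3.
    have [/(_ v) d3v _] := cubic u (nbr_in Nu) d3u.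
    by rewrite (d3v (nbrC vS Nu)) in d4.
  have [_ cu eu] := ch _ _ vS Nu.
  suff : #|child S v u| <= 1 by have := deg3 u (nbr_in Nu); lia.
  rewrite leqNgt; apply/negP => ch2.
  have : \sum_(u in nbr S v) 1 < \sum_(u in nbr S v) #|child S v u|.
    rewrite (bigD1 u) //= [X in _ < X](bigD1 u) //= -addSn leq_add //.
    by apply: leq_sum => x /andP[/le1].
  by rewrite sum1_card; lia.
have := sum_common_mod3 S.
by rewrite (eq_bigr (fun=> 2) cubic) sum_nat_const cardS.
Qed.

Lemma child_in v u x : x \in child S v u ->
  [/\ x \in S, adj u x, x != v & ~~ adj v x].
Proof. by rewrite inE => /and4P[]. Qed.

Lemma child_nbr v u x : x \in child S v u -> x \in nbr S u.
Proof. by case/child_in => xS ux _ _; rewrite inE xS. Qed.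

(** The inner condition keeps [r] away from [w] only. In the triangle case of [ten_absurd], these
    vertices turn out to lie beyond the second neighbourhood of [v]. *)
Definition grandchild v w := [set r | [exists x in child S v w, r \in child S w x]].

(** If both children of [w] have children of their own, these are distinct by [child_disjoint].
    Otherwise a childless [x] has degree 2 and forms a triangle with [w] and the other child [y];
    [edge_bound] at the edge [xy] then gives [y] two children, which are grandchildren. *)
Lemma ten_grandchild v u w : v \in S -> u != w -> nbr S v = [set u; w] ->
  adj u w -> #|child S v w| = 2 -> 2 <= #|grandchild v w|.
Proof.
move=> vS uw eN euw cw2.
have inN x : (x \in nbr S v) = (x == u) || (x == w) by rewrite eN !inE.
have Nw : w \in nbr S v by rewrite inN eqxx orbT.
have Nu : u \in nbr S v by rewrite inN eqxx.
have wS := nbr_in Nw.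
have [/existsP[x /andP[xC /eqP x0]]|] :=
  boolP [exists x, (x \in child S v w) && (#|child S w x| == 0)]; last first.
  rewrite negb_exists => /forallP H.
  have pos x : x \in child S v w -> exists r, r \in child S w x.
    by move=> xC; apply/card_gt0P; have := H x; rewrite xC lt0n.
  have /eqP/cards2P[x [y [xy eC]]] := cw2.
  have xC : x \in child S v w by rewrite eC !inE eqxx.
  have yC : y \in child S v w by rewrite eC !inE eqxx orbT.
  have [r rx] := pos x xC; have [s sy] := pos y yC.
  apply/card_gt1P; exists r, s; split.
  - by rewrite inE; apply/existsP; exists x; rewrite xC.
  - by rewrite inE; apply/existsP; exists y; rewrite yC.
  apply: contraTneq sy => <-.
  have /pred0P/(_ r) := child_disjoint (child_nbr xC) (child_nbr yC) xy.
  by rewrite /= rx /= => ->.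
have [xS wx xv vx] := child_in xC; have Nx := child_nbr xC.
have dx := card_nbr wS Nx; have := common_nbr_le1 Nx; rewrite x0 in dx.
have := deg2 xS => dx2 cx1.
have /card_gt0P[y] : 0 < #|common S w x| by lia.
rewrite inE => /and3P[yS wy xy].
have yC : y \in child S v w.
  rewrite inE yS wy /=; apply/andP; split.
    by apply: contraNneq vx => <-; rewrite adj_sym.
  apply/negP => vy; have : y \in nbr S v by rewrite inE yS.
  rewrite inN => /orP[] /eqP ey; last by rewrite ey adj_irrefl in wy.
  rewrite ey in xy vy; case/eqP: uw; rewrite eq_sym in xv.
  apply: (noC4 xv) => //; last by rewrite adj_sym.
  by have := nbrC vS Nw; rewrite inE vS adj_sym.
have Nxy : y \in nbr S x by rewrite inE yS.
have := edge4 xS Nxy; rewrite dx => edge_xy.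
suff sub : child S x y \subset grandchild v w.
  by apply: leq_trans (subset_leq_card sub); move: edge_xy cx1; clear; lia.
apply/subsetP => z /child_in[zS yz zx xz]; rewrite inE.
apply/existsP; exists y; rewrite yC inE zS yz /=; apply/andP; split.
  by apply: contraNneq xz => ->; rewrite adj_sym.
apply/negP => wz; case/eqP: zx; apply: (noC4 (adj_neq wy)) => //.
by rewrite adj_sym.
Qed.

(** A vertex [v] of degree 2 has neighbours [u] and [w] with exactly two children each. If [u] and
    [w] are adjacent, there are too many grandchildren; if not, deleting the edge [vu] with its
    neighbourhood leaves a set with too large a 1-sparse subset. *)
Lemma ten_absurd : False.
Proof.
have [v vS d2] := ten_degree2.
have /eqP/cards2P[u [w [uw eN]]] := d2.
have inN x : (x \in nbr S v) = (x == u) || (x == w) by rewrite eN !inE.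
have Nw : w \in nbr S v by rewrite inN eqxx orbT.
have Nu : u \in nbr S v by rewrite inN eqxx.
have [uS wS] := (nbr_in Nu, nbr_in Nw).
have sumC : \sum_(x in nbr S v) #|child S v x| = #|child S v u| + #|child S v w|.
  by rewrite eN big_setU1 ?inE // big_set1.
have [cu2 cw2] : #|child S v u| = 2 /\ #|child S v w| = 2.
  have := edge4 vS Nu; have := edge4 vS Nw; have := sum4 vS; lia.
have vu : adj v u by move: Nu; rewrite inE uS.
have vw : adj v w by move: Nw; rewrite inE wS.
have [euw|nuw] := boolP (adj u w).
  have Gw := ten_grandchild vS uw eN euw cw2.
  have Gu : 2 <= #|grandchild v u|.
    by apply: (@ten_grandchild v w u); rewrite // 1?eq_sym // 1?adj_sym // eN setUC.
  have split_child a b x r : nbr S v = [set a; b] -> adj a b ->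
      x \in child S v b -> r \in child S b x ->
      [/\ x != a, r != a, ~~ adj v r & ~~ adj a r].
    move=> eN' ab xC rC.
    have [xS bx xv vx] := child_in xC; have [rS xr rb br] := child_in rC.
    have : a \in nbr S v by rewrite eN' !inE eqxx.
    rewrite inE => /andP[_ va].
    have xa : x != a by apply: contraNneq vx => ->.
    have ar : ~~ adj a r.
      apply: contra_neqN rb => ar; apply: (noC4 xa) => //; by rewrite adj_sym.
    split=> //; first by apply: contraNneq br => ->; rewrite adj_sym.
    apply/negP => vr; have : r \in nbr S v by rewrite inE rS.
    rewrite eN' => /set2P[] er; last by rewrite er eqxx in rb.
    by rewrite er adj_sym ab in br.
  have sub a b : nbr S v = [set a; b] -> adj a b ->
      grandchild v b \subset S :\: (v |: nbr S v :|: dist2 S v).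
    move=> eN' ab; apply/subsetP => r; rewrite inE => /existsP[x /andP[xC rC]].
    have [_ _ vr ar] := split_child a b x r eN' ab xC rC.
    have [xS bx xv vx] := child_in xC; have [rS xr rb br] := child_in rC.
    rewrite !inE rS (negPf vr) !andbT /= orbF negb_or negb_and.
    have -> /= : r != v by apply: contraNneq vx => <-; rewrite adj_sym.
    apply/existsPn => p; rewrite eN' negb_and.
    have [/set2P[]->|//] := boolP (p \in _); by rewrite ?ar ?br orbT.
  (* A common grandchild [r] would close the 5-cycle [r x w u y]. *)
  have dGG : [disjoint grandchild v u & grandchild v w].
    apply/pred0Pn => -[r /andP[/= ]]; rewrite !inE.
    case/existsP=> y /andP[yC ry] /existsP[x /andP[xC rx]].
    have ewu : adj w u by rewrite adj_sym.
    have eN' : nbr S v = [set w; u] by rewrite eN setUC.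
    have [xu ru vr _] := split_child u w x r eN euw xC rx.
    have [yw rw _ _] := split_child w u y r eN' ewu yC ry.
    have [xS wx xv vx] := child_in xC; have [_ uy _ _] := child_in yC.
    have [rS xr _ _] := child_in rx; have [_ yr _ _] := child_in ry.
    have xy : x != y.
      apply: contraTneq yC => <-.
      by have /pred0P/(_ x) := child_disjoint Nu Nw uw; rewrite /= xC andbT => ->.
    have rx' : adj r x by rewrite adj_sym.
    have xw : adj x w by rewrite adj_sym.
    have := noC5 rx' xw ewu uy yr.
    rewrite /= !inE !negb_or xu xy ru rw (adj_neq rx') (adj_neq xw) (adj_neq ewu).
    by rewrite (adj_neq uy) (eq_sym w y) yw (eq_sym r) (adj_neq yr).
  (* Beyond the second neighbourhood there remain 10 - (1 + 2 + 4) vertices, too few for two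
     disjoint sets of two grandchildren. *)
  have cN3 : #|S :\: (v |: nbr S v :|: dist2 S v)| = 3.
    rewrite cardsD (setIidPr _); last first.
      rewrite !subUset sub1set vS; apply/andP; split; apply/subsetP => x.
        by move/nbr_in.
      by rewrite inE => /andP[].
    rewrite cardsU card_closed_nbr -sum_card_child sumC cu2 cw2 d2 cardS.
    have -> : (v |: nbr S v) :&: dist2 S v = set0; last by rewrite cards0.
    apply/setP => x; rewrite !inE; case: (x == v); rewrite ?andbF //=.
    by case: (adj v x); rewrite ?andbF.
  have : #|grandchild v u :|: grandchild v w| <= 3.
    rewrite -cN3; apply: subset_leq_card; rewrite subUset (sub u w) // andbT.
    by apply: (sub w u); rewrite 1?adj_sym // eN setUC.
  have /eqP -> : #|grandchild v u :|: grandchild v w| ==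
      #|grandchild v u| + #|grandchild v w| by rewrite (leq_card_setU _ _).2.
  by move: Gu Gw; clear; lia.
have cvw0 : #|common S v w| = 0.
  apply/eqP; rewrite cards_eq0; apply/eqP/setP => x; rewrite !inE.
  apply/negP => /and3P[xS vx wx]; have : x \in nbr S v by rewrite inE xS.
  rewrite inN => /orP[] /eqP ex; last by rewrite ex adj_irrefl in wx.
  by rewrite ex adj_sym (negPf nuw) in wx.
have dw3 : #|nbr S w| = 3 by have := card_nbr vS Nw; rewrite cw2 cvw0.
(* A childless [x] would have degree 2 and a common neighbour with [w]. Then [w], of degree 3, has
   only one child as seen from [x], against [edge_bound] at the edge [xw]. *)
have pos x : x \in child S v w -> exists r, r \in child S w x.
  move=> xC; apply/card_gt0P; rewrite lt0n; apply/negP => /eqP cx0.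
  have Nx := child_nbr xC; have xS := nbr_in Nx.
  have := card_nbr wS Nx; have := card_nbr xS (nbrC wS Nx).
  have := edge4 xS (nbrC wS Nx); have := common_nbr_le1 Nx.
  by have := deg2 xS; rewrite (commonC S w x) cx0 dw3; clear; lia.
have /eqP/cards2P[x [y [xy eC]]] := cw2.
have xC : x \in child S v w by rewrite eC !inE eqxx.
have yC : y \in child S v w by rewrite eC !inE eqxx orbT.
have [r rx] := pos x xC; have [s sy] := pos y yC.
(* The closed neighbourhood of the edge [vu] has at most 5 vertices. What remains contains [x], [y],
   [r], [s] and a fifth vertex [t], as [leq4_alpha1_children] requires. *)
pose R := S :\: (v |: nbr S v :|: child S v u).
have aR : alpha1 R <= 3.
  by have := leq_alpha1_edge vS Nu; move: alphaS; rewrite /R; clear; lia.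
have cR : 5 <= #|R|.
  have := cardsD S (v |: nbr S v :|: child S v u).
  have := subset_leq_card (subsetIr S (v |: nbr S v :|: child S v u)).
  by have := leq_card_edge_nbr S v u; rewrite /R cardS cu2 d2; clear; lia.
have xR z : z \in child S v w -> z \in R.
  move=> zC; have [zS wz zv vz] := child_in zC.
  rewrite in_setD zS !in_setU in_set1 (negPf zv) inE (negPf vz) andbF andbT /=.
  by have /pred0P/(_ z) := child_disjoint Nu Nw uw; rewrite /= zC andbT => ->.
have rR z q : z \in child S v w -> q \in child S w z -> q \in R.
  move=> zC qC; have [zS wz zv vz] := child_in zC.
  have [qS zq qw wq] := child_in qC.
  have [zw uv wv] : [/\ adj z w, adj u v & adj w v] by split; rewrite adj_sym.
  have qv : q != v by apply: contraNneq vz => <-; rewrite adj_sym.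
  have vq : ~~ adj v q.
    apply/negP => vq; have : q \in nbr S v by rewrite inE qS.
    rewrite inN (negPf qw) orbF => /eqP qu; rewrite qu in zq.
    by case/eqP: uw; apply: (noC4 zv).
  rewrite in_setD qS !in_setU in_set1 (negPf qv) !inE (negPf vq) !andbF andbT /=.
  rewrite qS qv !andbT /=; apply/negP => uq.
  have qz : adj q z by rewrite adj_sym.
  have := noC5 vu uq qz zw wv.
  rewrite /= !inE !negb_or uw (adj_neq vu) (adj_neq vw) (adj_neq uq) (adj_neq qz).
  rewrite (adj_neq zw) qw !(eq_sym v) zv qv.
  suff -> : u != z by [].
  by apply: contraNneq vz => <-.
have /card_gt0P[t] : 0 < #|R :\: [set z in [:: x; y; r; s]]|.
  have := cardsD R [set z in [:: x; y; r; s]].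
  have := subset_leq_card (subsetIr R [set z in [:: x; y; r; s]]).
  have : #|[set z in [:: x; y; r; s]]| <= 4 by rewrite cardsE card_size.
  by move: cR; clear; lia.
case/setDP=> tR; rewrite inE !inE !negb_or => /and4P[tx ty tr ts].
have [_ wx _ _] := child_in xC; have [_ wy _ _] := child_in yC.
have [_ xr rw wr] := child_in rx; have [_ ys sw ws] := child_in sy.
have tw : t != w.
  apply: contraTneq tR => ->; by rewrite in_setD !in_setU Nw !orbT.
suff : 4 <= alpha1 R by move: aR; clear; lia.
apply: (@leq4_alpha1_children R w x y r s t) => //.
  rewrite /= !inE !negb_or (adj_neq wx) (adj_neq wy) xy (adj_neq xr) (adj_neq ys).
  rewrite !(eq_sym _ t) tx ty tr ts tw !(eq_sym w) rw sw /= !andbT.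
  have -> : x != s by apply: contraNneq ws => <-.
  have -> : y != r by apply: contraNneq wr => <-.
  apply: contraTneq sy => <-.
  have /pred0P/(_ r) := child_disjoint (child_nbr xC) (child_nbr yC) xy.
  by rewrite /= rx /= => ->.
move=> z; rewrite !in_cons in_nil orbF => /or4P[/eqP->|/eqP->|/eqP->|].
- exact: xR.
- exact: xR.
- exact: (rR x).
- by case/orP=> /eqP->; first exact: (rR y).
Qed.

End Ten.

Lemma forces_22_10 : forces 22 10.
Proof.
(* In each call [m1] and [m2] come from the two preceding pairs, and [c] is the number of children
   that [edge_bound] then guarantees. Both size conditions hold with equality throughout. *)
have f4 : forces 4 3.
  by apply: (@forces_small 4 3 2 1 1) => //; [apply: forces2 | apply: forces1].
have f6 : forces 6 4 by apply: (@forces_small 6 4 4 2 2) => //; apply: forces2.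
have f8 : forces 8 5 by apply: (@forces_small 8 5 6 4 2).
have f10 : forces 10 6.
  apply: forces_card => S cS; rewrite leqNgt; apply/negP => aS.
  exact: (ten_absurd cS aS f8 f6).
have f13 : forces 13 7 by apply: (@forces_large 13 7 10 8 2).
have f16 : forces 16 8 by apply: (@forces_large 16 8 13 10 3).
have f19 : forces 19 9 by apply: (@forces_large 19 9 16 13 3).
exact: forces22.
Qed.

End Sparse.

(** * From perfect graphs without 1-dense 4-sets to excluded cycles *)

Lemma cards_uniq (T : finType) (s : seq T) : uniq s -> #|[set x in s]| = size s.
Proof. by rewrite cardsE => /card_uniqP. Qed.

Lemma dense1P (G : sgraph) (S : {set G}) :
  reflect {in S & &, forall x y z : G, y != x -> z != x ->
    ~~ adj x y -> ~~ adj x z -> y = z} (dense 1 S).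
Proof.
apply: (iffP forall_inP) => [dS x y z xS yS zS yx zx xy xz|dS x xS].
  by apply: (card_le1_eqP (dS x xS)); rewrite inE ?yS ?zS ?yx ?zx.
apply/card_le1_eqP => y z; rewrite !inE => /and3P[yS yx xy] /and3P[zS zx xz].
exact: (dS x).
Qed.

(** On four vertices, being 1-dense means that the missing edges form a matching, and the complement
    of a matching on four vertices contains a 4-cycle. Conversely, each vertex of a 4-cycle can miss
    only the opposite one. *)
Lemma C4_free_dense (G : sgraph) :
  C4_free G <-> ~ exists S : {set G}, dense 1 S /\ #|S| = 4.
Proof.
split=> [noC4 [S [/dense1P dS cS]]|nodense x y u v xy xu yu xv yv].
  have [a [b [c [d [abcd inS]]]]] :
      exists a b c d : G, uniq [:: a; b; c; d] /\ {subset [:: a; b; c; d] <= S}.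
    have /card_geqP[[|a [|b [|c [|d [|? ?]]]]] [us // _ sS]] : 4 <= #|S| by rewrite cS.
    by exists a, b, c, d.
  have C4 (x y u v : G) : x != y -> u != v ->
      adj x u -> adj y u -> adj x v -> adj y v -> False.
    by move=> xy /eqP uv xu yu xv yv; apply: uv; exact: (noC4 x y u v xy xu yu xv yv).
  have {inS} [aS bS cS' dS'] : [/\ a \in S, b \in S, c \in S & d \in S].
    by split; apply: inS; rewrite !inE eqxx ?orbT.
  move: abcd; rewrite /= !inE !negb_or => /and4P[/and3P[ab ac ad] /andP[bc bd] cd _].
  have D (p q r : G) : p \in S -> q \in S -> r \in S -> p != q -> p != r -> q != r ->
      ~~ adj p q -> adj p r.
    move=> pS qS rS pq pr /eqP qr npq; apply/negPn/negP => npr; apply: qr.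
    by apply: (dS p); rewrite // eq_sym.
  have [ba ca da] : [/\ b != a, c != a & d != a] by split; rewrite eq_sym.
  have [cb db dc] : [/\ c != b, d != b & d != c] by split; rewrite eq_sym.
  (* A missing edge makes its ends adjacent to both other vertices, which is a 4-cycle. If none of
     [ab], [cd], [ac], [bd] is missing, these four edges form one. *)
  have [eab|nab] := boolP (adj a b); last first.
    have nba : ~~ adj b a by rewrite adj_sym.
    by apply: (C4 a b c d) => //; [apply: (D a b) | apply: (D b a)
      | apply: (D a b) | apply: (D b a)].
  have [ecd|ncd] := boolP (adj c d); last first.
    have ndc : ~~ adj d c by rewrite adj_sym.
    by apply: (C4 c d a b) => //; [apply: (D c d) | apply: (D d c)
      | apply: (D c d) | apply: (D d c)].
  have [eba edc] : adj b a /\ adj d c by split; rewrite adj_sym.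
  have [eac|nac] := boolP (adj a c); last first.
    have nca : ~~ adj c a by rewrite adj_sym.
    by apply: (C4 a c b d) => //; [apply: (D c a) | apply: (D a c)].
  have [ebd|nbd] := boolP (adj b d); last first.
    have ndb : ~~ adj d b by rewrite adj_sym.
    by apply: (C4 b d a c) => //; [apply: (D d b) | apply: (D b d)].
  by apply: (C4 a d b c) => //; rewrite adj_sym.
apply/eqP/negPn/negP => uv; apply: nodense.
exists [set z in [:: x; y; u; v]]; split; last first.
  rewrite cards_uniq //= !inE !negb_or xy uv (adj_neq xu) (adj_neq xv).
  by rewrite (adj_neq yu) (adj_neq yv).
have [ux uy vx vy] : [/\ adj u x, adj u y, adj v x & adj v y].
  by split; rewrite adj_sym.
apply/dense1P => p q r; rewrite !inE.
by move=> /or4P[]/eqP-> /or4P[]/eqP-> /or4P[]/eqP->;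
  rewrite ?eqxx ?xu ?xv ?yu ?yv ?ux ?uy ?vx ?vy.
Qed.

(** A chord cuts a 5-cycle into a triangle and a 4-cycle. *)
Lemma C5_chordless (G : sgraph) (a b c d e : G) : C4_free G ->
  uniq [:: a; b; c; d; e] -> adj c d -> adj d e -> adj e a -> ~~ adj a c.
Proof.
move=> noC4; rewrite /= !inE !negb_or => /and5P[/and4P[_ _ ad _] _ /andP[_ ce] _ _].
move=> cd de ea; apply: contraNN ce => ac; apply/eqP.
by apply: (noC4 a d) => //; rewrite adj_sym.
Qed.

Lemma chromatic_numberP (G : sgraph) : colorable G (chromatic_number G).
Proof. by rewrite /chromatic_number; case: ex_minnP. Qed.

(** Without chords the 5-cycle is induced: its clique number is 2, but as an odd cycle it has no
    2-colouring. *)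
Lemma perfect_C5_free (G : sgraph) : C4_free G -> perfect G -> C5_free G.
Proof.
move=> noC4 perG a b c d e ab bc cd de ea; apply/negP => U.
have rotU (x y z u v : G) : uniq [:: x; y; z; u; v] -> uniq [:: y; z; u; v; x].
  by rewrite -(rot_uniq 1).
have U1 := rotU _ _ _ _ _ U; have U2 := rotU _ _ _ _ _ U1.
have U3 := rotU _ _ _ _ _ U2; have U4 := rotU _ _ _ _ _ U3.
have ac := negPf (C5_chordless noC4 U cd de ea).
have bd := negPf (C5_chordless noC4 U1 de ea ab).
have ce := negPf (C5_chordless noC4 U2 ea ab bc).
have da := negPf (C5_chordless noC4 U3 ab bc cd).
have eb := negPf (C5_chordless noC4 U4 bc cd de).
pose S := [set x in [:: a; b; c; d; e]].
have chi2 : chromatic_number (induced S) <= 2.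
  rewrite perG; apply/bigmax_leqP => K /forall_inP cK; rewrite leqNgt.
  apply/negP => /card_gt2P[x [y [z [[xK yK zK] [xy yz zx]]]]].
  have KA p q : p \in K -> q \in K -> p != q -> adj (val p) (val q).
    by move=> pK qK; apply: implyP; apply: (forall_inP (cK p pK)).
  have := KA _ _ zK xK zx; have := KA _ _ yK zK yz; have := KA _ _ xK yK xy.
  have inS (p : induced S) : val p \in [:: a; b; c; d; e].
    by have := valP p; rewrite inE.
  have := inS z; have := inS y; have := inS x; rewrite !inE.
  move=> /or3P[/eqP->|/eqP->|/or3P[/eqP->|/eqP->|/eqP->]]
    /or3P[/eqP->|/eqP->|/or3P[/eqP->|/eqP->|/eqP->]]
    /or3P[/eqP->|/eqP->|/or3P[/eqP->|/eqP->|/eqP->]];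
    rewrite ?adj_irrefl ?ac ?bd ?ce ?da ?eb //;
    by do 3![rewrite 1?adj_sym ?ac ?bd ?ce ?da ?eb // => _].
have /existsP[f /forallP col] := chromatic_numberP (induced S).
have diff x y (xS : x \in S) (yS : y \in S) : adj x y ->
    (f (exist _ x xS) : nat) != f (exist _ y yS).
  exact: (implyP (forallP (col (exist _ x xS)) (exist _ y yS))).
have lt2 x : f x < 2 by apply: leq_trans chi2.
have [aS bS cS dS eS] : [/\ a \in S, b \in S, c \in S, d \in S & e \in S].
  by rewrite !inE !eqxx !orbT.
have := diff _ _ aS bS ab; have := diff _ _ bS cS bc; have := diff _ _ cS dS cd.
have := diff _ _ dS eS de; have := diff _ _ eS aS ea.
move: (lt2 (exist _ a aS)) (lt2 (exist _ b bS)) (lt2 (exist _ c cS))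
  (lt2 (exist _ d dS)) (lt2 (exist _ e eS)).
move: (f _ : nat) (f _ : nat) (f _ : nat) (f _ : nat) (f _ : nat).
by clear; lia.
Qed.

(** * A criterion for perfection *)

Lemma clique_leq_chromatic (G : sgraph) : clique_number G <= chromatic_number G.
Proof.
apply/bigmax_leqP => K /forall_inP cK.
have /existsP[f /forallP col] := chromatic_numberP G.
rewrite -(card_ord (chromatic_number G)) -(card_in_imset (f := f)) ?max_card //.
move=> x y xK yK fxy; apply/eqP/negPn/negP => xy.
have := implyP (forallP (col x) y) (implyP (forall_inP (cK x xK) y yK) xy).
by rewrite fxy eqxx.
Qed.

(** A clique and a colouring of equal size squeeze the two numbers together. Both live in [G], with
    natural numbers as colours, so that applications avoid the subtype of vertices of
    [induced S]. *)
Lemma perfect_intro (G : sgraph) :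
  (forall S : {set G}, exists k,
     (exists K : {set G}, [/\ K \subset S, clique K & #|K| = k]) /\
     (exists c : G -> nat, {in S, forall x, c x < k} /\
        {in S &, forall x y, adj x y -> c x != c y})) ->
  perfect G.
Proof.
move=> H S; have [k [[K [KS cK eK]] [c [ck cadj]]]] := H S.
apply/eqP; rewrite eqn_leq clique_leq_chromatic andbT.
have chik : chromatic_number (induced S) <= k.
  rewrite /chromatic_number; case: ex_minnP => m _; apply.
  apply/existsP; exists [ffun x => Ordinal (ck (val x) (valP x))].
  apply/'forall_forallP => x y; apply/implyP => xy; rewrite !ffunE.
  by apply: contraTneq xy => -[/eqP]; apply: contraTN; apply: cadj; apply: valP.
apply: leq_trans chik _; rewrite -eK.
have -> : #|K| = #|[set x : induced S | val x \in K]|.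
  have -> : K = val @: [set x : induced S | val x \in K].
    apply/setP => x; apply/idP/imsetP => [xK|[y]]; last by rewrite inE => + ->.
    by exists (exist _ x (subsetP KS x xK)); rewrite // inE.
  rewrite card_imset; last exact: val_inj.
  by apply: eq_card => x; rewrite !inE mem_imset //; [rewrite inE | apply: val_inj].
apply: leq_bigmax_cond; apply/forall_inP => x; rewrite inE => xK.
apply/forall_inP => y; rewrite inE => yK; apply/implyP => xy.
by apply: (implyP (forall_inP (forall_inP cK _ xK) _ yK)).
Qed.

(** * Edge colouring of bipartite graphs of maximum degree 2 *)

Definition fibres_le2 (F : finType) (P : eqType) (q : F -> P) (S : {set F}) :=
  {in S & &, forall x y z, q x = q y -> q x = q z -> [|| x == y, x == z | y == z]}.

(* Koenig's theorem for maximum degree 2. If x and a share a p-class, deleting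
   both and merging their l-classes preserves the hypotheses, and any colouring
   of what remains leaves opposite colours for x and a. *)
Lemma two_colouring (F : finType) (P L : eqType) (p : F -> P) (l : F -> L)
    (S : {set F}) : fibres_le2 p S -> fibres_le2 l S ->
  exists c : F -> bool, {in S &, forall x y,
    x != y -> (p x == p y) || (l x == l y) -> c x != c y}.
Proof.
move: {2}#|S| (leqnn #|S|) => n; elim: n l S => [|n IH] l S.
  rewrite leqn0 cards_eq0 => /eqP-> _ _; exists xpredT => x y.
  by rewrite inE.
move=> Sn fp fl.
have [/exists_inP[x xS /exists_inP[a aS /andP[xa /eqP pxa]]]|nopair] :=
  boolP [exists x in S, exists a in S, (x != a) && (p x == p a)].
  pose S' := S :\ x :\ a; pose l' y := if l y == l a then l x else l y.
  have S'P y : (y \in S') = [&& y != a, y != x & y \in S] by rewrite !inE.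
  have flx y z : y \in S' -> z \in S' -> l y = l x -> l z = l x -> y = z.
    rewrite !S'P => /and3P[_ yx yS] /and3P[_ zx zS] lyx lzx.
    have := fl x y z xS yS zS (esym lyx) (esym lzx).
    by rewrite !(eq_sym x) (negPf yx) (negPf zx) => /eqP.
  have fla y z : y \in S' -> z \in S' -> l y = l a -> l z = l a -> y = z.
    rewrite !S'P => /and3P[ya _ yS] /and3P[za _ zS] lya lza.
    have := fl a y z aS yS zS (esym lya) (esym lza).
    by rewrite !(eq_sym a) (negPf ya) (negPf za) => /eqP.
  have pS' y : y \in S' -> p y != p x.
    rewrite S'P => /and3P[ya yx yS]; apply/eqP => pyx.
    have := fp x a y xS aS yS pxa (esym pyx).
    by rewrite (negPf xa) !(eq_sym _ y) (negPf ya) (negPf yx).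
  have fl' : fibres_le2 l' S'.
    move=> y z w yS zS wS; rewrite /l'.
    case: eqP => ya; case: eqP => za; case: eqP => wa e1 e2.
    - by rewrite (fla y z) ?eqxx.
    - by rewrite (fla y z) ?eqxx.
    - by rewrite (fla y w) ?eqxx ?orbT.
    - by rewrite (flx z w) ?eqxx ?orbT.
    - by rewrite (fla z w) ?eqxx ?orbT.
    - by rewrite (flx y w) ?eqxx ?orbT // -e2.
    - by rewrite (flx y z) ?eqxx // -e1.
    move: yS zS wS; rewrite !S'P => /and3P[_ _ yS] /and3P[_ _ zS] /and3P[_ _ wS].
    exact: fl.
  have fp' : fibres_le2 p S'.
    move=> y z w; rewrite !S'P => /and3P[_ _ yS] /and3P[_ _ zS] /and3P[_ _ wS].
    exact: fp.
  have cS' : #|S'| <= n.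
    move: Sn; rewrite (cardsD1 x) xS (cardsD1 a) -/S'.
    by rewrite !inE (eq_sym a) xa aS; lia.
  have [c cP] := IH l' S' cS' fp' fl'.
  (* The colour [b] is meant for [x] and [~~ b] for [a]. Each has at most one remaining [l]-mate,
     and if both mates exist, the merged class has given them different colours. *)
  have [b [bx ba]] : exists b, {in S', forall y, l y = l x -> c y != b} /\
      {in S', forall y, l y = l a -> c y = b}.
    have [/exists_inP[y yS /eqP lyx]|nx] := boolP [exists y in S', l y == l x].
      exists (~~ c y); split=> z zS lz.
        by rewrite (flx z y) //; case: (c y).
      have yz : y != z.
        apply: contraTneq zS => ezy; rewrite S'P -ezy; apply/negP => /and3P[ya yx yS1].
        have := fl x a y xS aS yS1; rewrite -ezy lyx in lz.
        rewrite lyx lz => /(_ erefl erefl).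
        by rewrite (negPf xa) !(eq_sym _ y) (negPf yx) (negPf ya).
      have := cP y z yS zS yz; rewrite /l' lyx lz eqxx if_same eqxx orbT => /(_ isT).
      by case: (c y); case: (c z).
    have nx' z : z \in S' -> l z = l x -> False.
      by move=> zS /eqP lz; move/exists_inP: nx; apply; exists z.
    have [/exists_inP[y yS /eqP lya]|na] := boolP [exists y in S', l y == l a].
      by exists (c y); split=> z zS lz; [case: (nx' z) | rewrite (fla z y)].
    exists true; split=> z zS lz; first by case: (nx' z).
    by case/exists_inP: na; exists z; rewrite ?lz.
  exists (fun y => if y == x then b else if y == a then ~~ b else c y) => s t sS tS.
  have inS' y : y \in S -> y != x -> y != a -> y \in S'.
    by rewrite S'P => -> -> ->.
  have xrel y : y \in S' -> (p x == p y) || (l x == l y) -> c y != b.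
    move=> yS; rewrite eq_sym (negPf (pS' y yS)) => /eqP lxy.
    exact: bx.
  have arel y : y \in S' -> (p a == p y) || (l a == l y) -> c y = b.
    move=> yS; rewrite -pxa eq_sym (negPf (pS' y yS)) => /eqP lay.
    exact: ba.
  have sym (q r : F) : (p q == p r) || (l q == l r) = (p r == p q) || (l r == l q).
    by rewrite (eq_sym (p q)) (eq_sym (l q)).
  have [->|sx] := eqVneq s x; have [->|tx] := eqVneq t x.
  - by rewrite eqxx.
  - have [->|ta] := eqVneq t a; first by case: (b).
    by move=> _ /xrel; rewrite eq_sym inS' // => /(_ isT).
  - have [->|sa] := eqVneq s a; first by case: (b).
    by move=> _; rewrite sym => /xrel; rewrite inS' // => /(_ isT).
  have [->|sa] := eqVneq s a; have [->|ta] := eqVneq t a.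
  - by rewrite eqxx.
  - by move=> _ /arel ->; rewrite ?inS' //; case: (b).
  - by move=> _; rewrite sym => /arel ->; rewrite ?inS' //; case: (b).
  move=> st rel; apply: cP; rewrite ?inS' //.
  by case/orP: rel => [->//|/eqP lst]; rewrite /l' lst eqxx orbT.
(* No [p]-class is shared any more, so a removed [x] only has to differ from at most one
   [l]-mate. *)
have [->|[x xS]] := set_0Vmem S; first by exists xpredT => ? ?; rewrite inE.
have [|y z w||c cP] := IH l (S :\ x).
- by move: Sn; rewrite (cardsD1 x) xS.
- by rewrite !inE => /andP[_ yS] /andP[_ zS] /andP[_ wS]; apply: fp.
- by move=> y z w; rewrite !inE => /andP[_ yS] /andP[_ zS] /andP[_ wS]; apply: fl.
have pinj y z : y \in S -> z \in S -> y != z -> p y != p z.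
  move=> yS zS yz; apply: contraNN nopair => pyz.
  by apply/exists_inP; exists y => //; apply/exists_inP; exists z; rewrite // yz.
have [b bx] : exists b, {in S :\ x, forall y, l y = l x -> c y != b}.
  have [/exists_inP[y]|nx] := boolP [exists y in S :\ x, l y == l x].
    rewrite !inE => /andP[yx yS] /eqP lyx; exists (~~ c y) => z.
    rewrite !inE => /andP[zx zS] lzx; have := fl x y z xS yS zS (esym lyx) (esym lzx).
    by rewrite !(eq_sym x) (negPf yx) (negPf zx) => /eqP->; case: (c z).
  exists true => z zS lz; case/exists_inP: nx; exists z; rewrite ?lz //.
exists (fun y => if y == x then b else c y) => s t sS tS.
have [->|sx] := eqVneq s x; have [->|tx] := eqVneq t x.
- by rewrite eqxx.
- move=> _; rewrite (negPf (pinj _ _ xS tS _)) 1?eq_sym // => /eqP lxt.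
  by rewrite eq_sym bx // !inE tx.
- move=> _; rewrite (negPf (pinj _ _ sS xS sx)) => /eqP lsx.
  by rewrite bx // !inE sx.
by move=> st rel; apply: cP; rewrite // !inE ?sx ?tx.
Qed.

(** * Line graphs of bipartite graphs *)

Section FlagGraph.
Variables (F P L : finType) (p : F -> P) (l : F -> L).
Hypothesis pl_inj : forall x y, p x = p y -> l x = l y -> x = y.

(** Reading each [x : F] as an edge between [p x] and [l x], this is adjacency in the line graph of
    a bipartite graph with parts [P] and [L]; [pl_inj] excludes parallel edges. *)
Definition flag_adj : rel F :=
  fun x y => (x != y) && ((p x == p y) || (l x == l y)).

Lemma flag_adj_sym : symmetric flag_adj.
Proof. by move=> x y; rewrite /flag_adj eq_sym (eq_sym (p x)) (eq_sym (l x)). Qed.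

Lemma flag_adj_irrefl : irreflexive flag_adj.
Proof. by move=> x; rewrite /flag_adj eqxx. Qed.

Definition flag_graph : sgraph := SGraph flag_adj_sym flag_adj_irrefl.

Lemma fibres_le2_card (Q : eqType) (q : F -> Q) (S : {set F}) :
  (forall x, x \in S -> #|[set y in S | q y == q x]| <= 2) -> fibres_le2 q S.
Proof.
move=> le2 x y z xS yS zS qxy qxz; apply: contraLR (le2 x xS).
rewrite !negb_or -ltnNge => /and3P[xy xz yz]; apply/card_gt2P; exists x, y, z.
by rewrite !inE xS yS zS -qxy -qxz eqxx xy yz eq_sym xz.
Qed.

Lemma flag_clique (Q : eqType) (q : F -> Q) (S : {set F}) x :
  (forall y z, q y = q z -> y != z -> flag_adj y z) ->
  2 < #|[set y in S | q y == q x]| ->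
  exists K : {set flag_graph}, [/\ K \subset S, clique K & #|K| = 3].
Proof.
move=> qadj /card_gt2P[a [b [c [[]]]]]; rewrite !inE.
move=> /andP[aS /eqP qa] /andP[bS /eqP qb] /andP[cS /eqP qc] [ab bc ca].
exists [set z in [:: a; b; c]]; split.
- by apply/subsetP => z; rewrite !inE => /or3P[]/eqP->.
- have qK z : z \in [set z in [:: a; b; c]] -> q z = q x.
    by rewrite !inE => /or3P[]/eqP->.
  apply/forall_inP => y yK; apply/forall_inP => z zK; apply/implyP => yz.
  by apply: qadj => //; rewrite (qK y) ?(qK z).
by rewrite cards_uniq //= !inE negb_or ab bc eq_sym ca.
Qed.

(** If three elements of [S] share a class, they form a triangle and [c3] is an optimal colouring.
    Otherwise all classes in [S] have at most two elements, and [two_colouring] matches the size of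
    an edge; edgeless sets need at most one colour. *)
Lemma flag_graph_perfect (c3 : F -> nat) :
  (forall x, c3 x < 3) -> (forall x y, flag_adj x y -> c3 x != c3 y) ->
  perfect flag_graph.
Proof.
move=> c3lt c3adj; apply: perfect_intro => S.
have padj y z : p y = p z -> y != z -> flag_adj y z.
  by rewrite /flag_adj => -> ->; rewrite eqxx.
have ladj y z : l y = l z -> y != z -> flag_adj y z.
  by rewrite /flag_adj => -> ->; rewrite eqxx orbT.
have [/exists_inP[x xS x3]|np] :=
  boolP [exists x in S, 2 < #|[set y in S | p y == p x]|].
  exists 3; split; first exact: flag_clique x3.
  by exists c3; split=> [x' _|x' y _ _]; [apply: c3lt | apply: c3adj].
have [/exists_inP[x xS x3]|nl] :=
  boolP [exists x in S, 2 < #|[set y in S | l y == l x]|].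
  exists 3; split; first exact: flag_clique x3.
  by exists c3; split=> [x' _|x' y _ _]; [apply: c3lt | apply: c3adj].
have [|/exists_inPn noadj] := boolP [exists x in S, exists y in S, flag_adj x y].
  case/exists_inP=> x xS /exists_inP[y yS xy]; exists 2; split.
    have nxy : x != y by case/andP: xy.
    exists [set x; y]; split; first by rewrite subUset !sub1set xS.
      apply/forall_inP => u /set2P[]->; apply/forall_inP => v /set2P[]->;
        apply/implyP; rewrite ?eqxx //= => _; by [|rewrite flag_adj_sym].
    by rewrite cards2 nxy.
  have [||c cP] := @two_colouring F P L p l S.
  - by apply: fibres_le2_card => z zS; rewrite leqNgt; apply: (exists_inPn np).
  - by apply: fibres_le2_card => z zS; rewrite leqNgt; apply: (exists_inPn nl).
  exists (fun z => c z : nat); split=> [z _|u v uS vS]; first by case: (c z).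
  case/andP=> uv rel; have := cP u v uS vS uv rel.
  by case: (c u); case: (c v).
have [->|[x xS]] := set_0Vmem S.
  exists 0; split; last by exists c3; split=> x; rewrite inE.
  exists set0; split; rewrite ?sub0set ?cards0 //.
  by apply/forall_inP => x; rewrite inE.
exists 1; split.
  exists [set x]; split; rewrite ?sub1set ?cards1 //.
  apply/forall_inP => u /set1P->; apply/forall_inP => v /set1P->.
  by rewrite eqxx.
exists (fun=> 0); split=> // u v uS vS uv.
by case/exists_inP: (noadj u uS); exists v.
Qed.

Definition shared (Q : eqType) (q : F -> Q) (T : {set F}) :=
  [set x in T | [exists y in T, (y != x) && (q y == q x)]].

(** Counted class by class: a class with one element of [T] contributes 2 on the left and 2 from
    [Q], a class with two contributes 4 on the left and 2 + 2 on the right. *)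
Lemma card_shared (Q : finType) (q : F -> Q) (T : {set F}) :
  fibres_le2 q T -> 2 * #|T| <= #|shared q T| + 2 * #|Q|.
Proof.
move=> fq.
have fib (A : {set F}) : #|A| = \sum_(i : Q) #|[set x in A | q x == i]|.
  rewrite -sum1_card (partition_big q predT) //=.
  by apply: eq_bigr => i _; rewrite -sum1_card; apply: eq_bigl => x; rewrite !inE.
rewrite (fib T) (fib (shared q T)) mulnC.
have -> : 2 * #|Q| = \sum_(i : Q) 2 by rewrite sum_nat_const mulnC.
rewrite big_distrl -big_split; apply: leq_sum => i _ /=.
have [le1|] := leqP #|[set x in T | q x == i]| 1; first by lia.
have [le2|] := leqP #|[set x in T | q x == i]| 2; last first.
  case/card_gt2P=> a [b [c [[]]]]; rewrite !inE.
  move=> /andP[aT /eqP qa] /andP[bT /eqP qb] /andP[cT /eqP qc] [ab bc ca].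
  have := fq a b c aT bT cT; rewrite qa qb qc => /(_ erefl erefl).
  by rewrite (negPf ab) (negPf bc) eq_sym (negPf ca).
move=> gt1.
suff : #|[set x in T | q x == i]| <= #|[set x in shared q T | q x == i]| by lia.
apply: subset_leq_card; apply/subsetP => x; rewrite !inE => /andP[xT /eqP qx].
rewrite xT qx eqxx andbT /=; case/card_gt1P: gt1 => a [b []]; rewrite !inE.
move=> /andP[aT /eqP qa] /andP[bT /eqP qb] ab; apply/exists_inP.
have [eax|ax] := eqVneq a x; last by exists a; rewrite ?qa ?eqxx ?ax.
by exists b; rewrite // qb eqxx andbT -eax eq_sym.
Qed.

(** An element of [T] with both a [p]-mate and an [l]-mate would have two neighbours in [T],
    distinct by [pl_inj]. So the two [shared] sets are disjoint, and adding [card_shared] for [p]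
    and [l] gives the bound. *)
Lemma sparse_flag_graph (T : {set F}) :
  @sparse flag_graph 1 T -> 3 * #|T| <= 2 * (#|P| + #|L|).
Proof.
move=> /sparse1P sT.
have fib (Q : eqType) (q : F -> Q) :
    (forall y z, q y = q z -> y != z -> flag_adj y z) -> fibres_le2 q T.
  move=> qadj x y z xT yT zT qxy qxz.
  have [//|xy] := eqVneq x y; have [//|xz] := eqVneq x z.
  by rewrite (sT x y z xT yT zT (qadj _ _ qxy xy) (qadj _ _ qxz xz)) eqxx.
have padj y z : p y = p z -> y != z -> flag_adj y z.
  by rewrite /flag_adj => -> ->; rewrite eqxx.
have ladj y z : l y = l z -> y != z -> flag_adj y z.
  by rewrite /flag_adj => -> ->; rewrite eqxx orbT.
have := card_shared (fib _ p padj); have := card_shared (fib _ l ladj).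
suff : #|shared p T| + #|shared l T| <= #|T| by lia.
have dis : [disjoint shared p T & shared l T].
  apply/pred0Pn => -[x /andP[]] /=; rewrite !inE.
  case/andP=> xT /exists_inP[y yT /andP[yx /eqP pyx]].
  case/andP=> _ /exists_inP[z zT /andP[zx /eqP lzx]].
  have xy : flag_adj x y by apply: padj; rewrite // eq_sym.
  have xz : flag_adj x z by apply: ladj; rewrite // eq_sym.
  have yz := sT x y z xT yT zT xy xz.
  by case/eqP: yx; apply: pl_inj; rewrite // yz.
have /eqP <- : #|shared p T :|: shared l T| == #|shared p T| + #|shared l T|.
  by rewrite (leq_card_setU _ _).2.
by apply: subset_leq_card; apply/subsetP => x; rewrite !inE => /orP[]/andP[].
Qed.

End FlagGraph.

(** * The Heawood graph and the lower bound *)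

(* The Heawood graph as the Fano plane with points Z/7 and lines i + {0, 1, 3}:
   flag x is the point x %/ 3 on the line through it with offset indexed by
   x %% 3. *)
Definition fano_line (x : nat) := (x %/ 3 + nth 0 [:: 0; 1; 3] (x %% 3)) %% 7.

Definition fano_adj (x y : nat) :=
  (x != y) && ((x %/ 3 == y %/ 3) || (fano_line x == fano_line y)).

(** The offset is a proper 3-edge-colouring of the Heawood graph: together with the point, or with
    the line, it determines the flag. *)
Lemma fano_colouring x y : x < 21 -> y < 21 -> fano_adj x y -> x %% 3 != y %% 3.
Proof.
have chk : all (fun x => all (fun y => fano_adj x y ==> (x %% 3 != y %% 3))
  (iota 0 21)) (iota 0 21) by vm_compute.
move=> x21 y21; have /allP/(_ x) := chk; rewrite mem_iota => /(_ x21).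
by move/allP/(_ y); rewrite mem_iota => /(_ y21)/implyP.
Qed.

Lemma fano_flag_inj x y : x < 21 -> y < 21 ->
  x %/ 3 = y %/ 3 -> fano_line x = fano_line y -> x = y.
Proof.
have chk : all (fun x => all (fun y =>
  (x %/ 3 == y %/ 3) && (fano_line x == fano_line y) ==> (x == y))
  (iota 0 21)) (iota 0 21) by vm_compute.
move=> x21 y21 pxy lxy; have /allP/(_ x) := chk; rewrite mem_iota => /(_ x21).
move/allP/(_ y); rewrite mem_iota => /(_ y21)/implyP.
by rewrite pxy lxy !eqxx => /(_ isT)/eqP.
Qed.

(** In a triangle-free graph, a 4-cycle of the line graph comes from a 4-cycle or from four edges at
    one vertex; the Heawood graph is cubic of girth 6. The check is exhaustive. *)
Lemma fano_C4_free x y u v : x < 21 -> y < 21 -> u < 21 -> v < 21 -> x != y ->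
  fano_adj x u -> fano_adj y u -> fano_adj x v -> fano_adj y v -> u = v.
Proof.
pose common x y := [seq u <- iota 0 21 | fano_adj x u && fano_adj y u].
have chk : all (fun x => all (fun y => (x == y) || (size (common x y) <= 1))
  (iota 0 21)) (iota 0 21) by vm_compute.
move=> x21 y21 u21 v21 xy xu yu xv yv.
have inC w : w < 21 -> fano_adj x w -> fano_adj y w -> w \in common x y.
  by move=> w21 xw yw; rewrite mem_filter xw yw mem_iota.
have := inC u u21 xu yu; have := inC v v21 xv yv.
have /allP/(_ x) := chk; rewrite mem_iota => /(_ x21).
move/allP/(_ y); rewrite mem_iota (negPf xy) orFb => /(_ y21).
move: (common x y) => [//|w [|//]] _.
by rewrite !inE => /eqP-> /eqP->.
Qed.

Theorem theorem3p3 : is_ramsey_number perfect 1 4 10 22.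
Proof.
split=> [G perG cG|m ram].
  have [/existsP[S /andP[dS /eqP cS]]|nodense] :=
    boolP [exists S : {set G}, dense 1 S && (#|S| == 4)].
    by left; exists S.
  have noC4 : C4_free G.
    apply/C4_free_dense => -[S [dS cS]]; move/existsP: nodense; apply.
    by exists S; rewrite dS cS.
  right; apply: (@alpha1_sparse_set _ [set: G]).
  by apply: (forces_22_10 noC4 (perfect_C5_free noC4 perG)); rewrite cardsT cG.
rewrite leqNgt; apply/negP => m22.
have lt21 (x : 'I_m) : x < 21 by apply: leq_trans (ltn_ord x) _.
(* Every [m] below 22 has to be refuted, so the graph consists of the first [m] flags only. *)
pose p (x : 'I_m) : 'I_7 := inord (x %/ 3).
pose l (x : 'I_m) : 'I_7 := inord (fano_line x).
have adjE (x y : 'I_m) : flag_adj p l x y = fano_adj x y.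
  have := lt21 x; have := lt21 y => y21 x21.
  rewrite /flag_adj /fano_adj -!(inj_eq val_inj) /p /l /= !inordK ?ltn_pmod //; lia.
have inj (x y : 'I_m) : p x = p y -> l x = l y -> x = y.
  move=> /(congr1 val) + /(congr1 val); rewrite /p /l /= !inordK ?ltn_pmod //;
    try by have := lt21 x; have := lt21 y; lia.
  by move=> pxy lxy; apply/val_inj/(fano_flag_inj (lt21 x) (lt21 y)).
have perG : perfect (flag_graph p l).
  apply: (@flag_graph_perfect _ _ _ p l (fun x : 'I_m => x %% 3)) => [x|x y].
    exact: ltn_pmod.
  by rewrite adjE; apply: fano_colouring (lt21 x) (lt21 y).
have [[S [dS cS]]|[S [sS cS]]] := ram _ perG (card_ord m).
  have noC4 : C4_free (flag_graph p l).
    move=> x y u v xy; rewrite /adj /= !adjE => *.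
    by apply/val_inj/(@fano_C4_free x y) => //; apply: lt21.
  by case: ((C4_free_dense _).1 noC4); exists S.
(* The bound would read 3 * 10 <= 2 * (7 + 7). *)
by have := sparse_flag_graph inj sS; rewrite cS !card_ord.
Qed.
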